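(* Let $K\ge 2$, $n\ge 1$, $L\ge 1$ and $d\ge K$ be integers. Consider the optimization problem $$(\mathrm{P})\qquad \min_{W_L,\dots,W_1,H_1}\ \|H_1\|_F^2+\sum_{l=1}^L\|W_l\|_F^2\quad\text{s.t.}\quad (z_{ic})_c-(z_{ic})_{c'}\ge 1\ \text{ for all } c'\neq c\in\{1,\dots,K\},\ i\in\{1,\dots,n\},$$ over $W_L\in\mathbb{R}^{K\times d}$, $W_{L-1},\dots,W_1\in\mathbb{R}^{d\times d}$, $H_1\in\mathbb{R}^{d\times nK}$, where $z_{ic}$ is the column of $Z=W_LW_{L-1}\cdots W_1H_1$ indexed by sample $i$ of class $c$. Let $\Theta^*=(W_L^*,\dots,W_1^*,H_1^* )$ be a DNC point, i.e. a parameter tuple satisfying the balancedness relations $(W_l^* )^TW_l^*=W_{l-1}^*(W_{l-1}^* )^T$ for $l=1,\dots,L$ (with $W_0^*:=H_1^*$) and whose logit matrix is $Z(\Theta^* )=S\otimes 1_n^T$ (so all constraints are tight). If either $L=2$ and $K\ge 6$, or $L\ge 3$ and $K\ge 4$, then: (i) $\Theta^*$ is not a global minimizer of (P), i.e. there exists a feasible tuple with strictly smaller objective value; and (ii) $\Theta^*$ is a local minimizer of (P), i.e. there is a neighbourhood of $\Theta^*$ in which every feasible tuple has objective value at least that of $\Theta^*$. In particular (P) has multiple distinct local minima.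
   Context: $S=I_K-\frac1K 1_K1_K^T$ is the simplex ETF matrix; $1_m$ is the all-ones vector in $\mathbb{R}^m$; $\otimes$ is the Kronecker product; $\|\cdot\|_F$ is the Frobenius norm. The $nK$ columns of $H_1$ (and of $Z$) are ordered by class: column $(c-1)n+i$ corresponds to sample $i$ of class $c$, and $(z_{ic})_c$ denotes the $c$-th entry of that column. *)

(* Defs.v *)
From HB Require Import structures.
From mathcomp Require Import all_boot all_order all_algebra.
From mathcomp Require Import reals.
Set Implicit Arguments. Unset Strict Implicit. Unset Printing Implicit Defensive.
Import Order.TTheory GRing.Theory Num.Theory.
Local Open Scope ring_scope.

Section DNC.
Variables (R : realType) (K n d L : nat).

Definition frob2 (p q : nat) (A : 'M[R]_(p, q)) : R :=
  \sum_(i < p) \sum_(j < q) A i j ^+ 2.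

Lemma col_idx_proof (c : 'I_K) (i : 'I_n) : (c * n + i < K * n)%N.
Proof.
have hc := ltn_ord c; have hi := ltn_ord i.
apply: (@leq_trans (c * n + n)); first by rewrite ltn_add2l.
by rewrite -mulSnr leq_mul2r hc orbT.
Qed.
Definition col_idx (c : 'I_K) (i : 'I_n) : 'I_(K * n) := Ordinal (col_idx_proof c i).

(* Parameters: WL : K x d ;  Wm l : d x d is W_l for 1 <= l <= L-1
   (values of Wm at other indices are irrelevant) ; H1 : d x nK. *)

Fixpoint mid_prod (Wm : nat -> 'M[R]_d) (k : nat) : 'M[R]_d :=
  match k with
  | 0 => 1%:M
  | k'.+1 => Wm k'.+1 *m mid_prod Wm k'
  end.

Definition logits (WL : 'M[R]_(K, d)) (Wm : nat -> 'M[R]_d) (H1 : 'M[R]_(d, K * n))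
  : 'M[R]_(K, K * n) := WL *m mid_prod Wm L.-1 *m H1.

Definition feasible WL Wm H1 : Prop :=
  forall (c c' : 'I_K) (i : 'I_n), c' != c ->
    1 <= logits WL Wm H1 c (col_idx c i) - logits WL Wm H1 c' (col_idx c i).

Definition objective (WL : 'M[R]_(K, d)) (Wm : nat -> 'M[R]_d) (H1 : 'M[R]_(d, K * n)) : R :=
  frob2 H1 + frob2 WL + \sum_(1 <= l < L) frob2 (Wm l).

Definition param_dist (WL WL' : 'M[R]_(K, d)) (Wm Wm' : nat -> 'M[R]_d)
  (H1 H1' : 'M[R]_(d, K * n)) : R :=
  frob2 (WL - WL') + frob2 (H1 - H1') + \sum_(1 <= l < L) frob2 (Wm l - Wm' l).

Definition gram_left (WL : 'M[R]_(K, d)) (Wm : nat -> 'M[R]_d) (l : nat) : 'M[R]_d :=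
  if l == L then WL^T *m WL else (Wm l)^T *m Wm l.
Definition gram_right (Wm : nat -> 'M[R]_d) (H1 : 'M[R]_(d, K * n)) (l : nat) : 'M[R]_d :=
  if l == 1%N then H1 *m H1^T else Wm l.-1 *m (Wm l.-1)^T.

Definition balanced WL Wm H1 : Prop :=
  forall l : nat, (1 <= l <= L)%N -> gram_left WL Wm l = gram_right Wm H1 l.

Definition simplexETF : 'M[R]_K := 1%:M - (K%:R)^-1 *: const_mx 1.

Definition DNC_point WL Wm H1 : Prop :=
  balanced WL Wm H1 /\
  forall (c c' : 'I_K) (i : 'I_n), logits WL Wm H1 c (col_idx c' i) = simplexETF c c'.

End DNC.

(* Main.v *)
(* Lower bound. Write k = K - 1 and let the rows of U be an orthonormal basis of the hyperplane
   orthogonal to the all-ones vector. Peeling LQ factors off the chain from the left compresses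
   every factor to a k x k triangular one without increasing Frobenius norms, so Hadamard's
   inequality and AM-GM bound det (U Z' V^T)^2 by (objective / (k (L+1)))^(k (L+1)) for every V
   with orthonormal rows. For V = U Z* / sqrt n this bound is attained at the DNC point, because
   all the singular values of Z* equal sqrt n.
   Local minimality. At a feasible point U Z' V^T = sqrt n (1 + E), where tr E is the mean of the
   nonnegative constraint slacks, up to a factor, and bounds every entry of E, the hyperplane
   components of Z' - Z* being determined by the slacks. Hence det (1 + E) >= 1 + tr E - O((tr E)^2)
   >= 1 near the DNC point, and the lower bound gives the claim.
   Non-optimality. Group the classes into pairs sharing one hidden direction with opposite signs:
   the logits have only about K/2 nonzero singular values, each at most 2 sqrt n, and the exponent
   2/(L+1) makes this cheaper than K - 1 singular values sqrt n. *)
Require Import Defs.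
From HB Require Import structures.
From mathcomp Require Import all_boot all_order all_algebra.
From mathcomp Require Import all_fingroup.
From mathcomp Require Import reals.
From mathcomp Require Import zify ring lra.
Import Order.TTheory GRing.Theory Num.Theory.
Local Open Scope ring_scope.
Set Implicit Arguments.
Unset Strict Implicit.
Unset Printing Implicit Defensive.

(** * Frobenius norms under orthonormal compression, and the LQ factorization *)

Section Frobenius.
Variable R : realType.

Lemma frob2E p q (A : 'M[R]_(p, q)) : frob2 A = \tr (A *m A^T).
Proof.
apply: eq_bigr => i _; rewrite mxE; apply: eq_bigr => j _.
by rewrite mxE expr2.
Qed.

Lemma frob2_ge0 p q (A : 'M[R]_(p, q)) : 0 <= frob2 A.
Proof. by do 2!apply: sumr_ge0 => ? _; apply: sqr_ge0. Qed.

Lemma frob2_tr p q (A : 'M[R]_(p, q)) : frob2 A^T = frob2 A.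
Proof. by rewrite !frob2E trmxK mxtrace_mulC. Qed.

Lemma sqr_le_frob2 p q (A : 'M[R]_(p, q)) i j : A i j ^+ 2 <= frob2 A.
Proof.
rewrite /frob2 (bigD1 i) //= (bigD1 j) //= -addrA lerDl.
by rewrite addr_ge0 //; do ?apply: sumr_ge0 => ? _; rewrite ?sqr_ge0.
Qed.

Lemma frob2_eq0 p q (A : 'M[R]_(p, q)) : frob2 A = 0 -> A = 0.
Proof.
move=> A0; apply/matrixP => i j; rewrite mxE; apply/eqP.
by rewrite -sqrf_eq0 eq_le sqr_ge0 andbT -A0 sqr_le_frob2.
Qed.

Lemma mulTmx_eq0 p q (A : 'M[R]_(p, q)) : A^T *m A = 0 -> A = 0.
Proof. by move=> A0; apply: frob2_eq0; rewrite frob2E mxtrace_mulC A0 mxtrace0. Qed.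

Lemma frob2_isometry p q r (A : 'M[R]_(p, q)) (Q : 'M[R]_(q, r)) :
  Q *m Q^T = 1%:M -> frob2 (A *m Q) = frob2 A.
Proof. by move=> QQ; rewrite !frob2E trmx_mul mulmxA -(mulmxA A) QQ mulmx1. Qed.

(** Pythagoras: [Q^T *m Q] is an orthogonal projection, so [A] splits into [Q^T *m (Q *m A)], of the
    same norm as [Q *m A], and an orthogonal residue. *)
Lemma frob2_compression p q r (Q : 'M[R]_(p, q)) (A : 'M[R]_(q, r)) :
  Q *m Q^T = 1%:M -> frob2 (Q *m A) <= frob2 A.
Proof.
move=> QQ; suff -> : frob2 A = frob2 (Q *m A) + frob2 (A - Q^T *m (Q *m A)).
  by rewrite lerDl frob2_ge0.
have trB : (A - Q^T *m (Q *m A))^T = A^T - A^T *m Q^T *m Q.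
  by rewrite linearB /= !trmx_mul trmxK.
rewrite -(frob2_tr (Q *m A)) -(frob2_tr A) -(frob2_tr (A - _)) !frob2E !trmxK trB.
rewrite trmx_mul mulmxBl !mulmxBr !mulmxA -(mulmxA (A^T *m Q^T) Q Q^T) QQ mulmx1.
by rewrite subrr subr0 linearB addrC subrK.
Qed.

Lemma frob2_compressionr p q r (Q : 'M[R]_(p, q)) (A : 'M[R]_(r, q)) :
  Q *m Q^T = 1%:M -> frob2 (A *m Q^T) <= frob2 A.
Proof. by move=> QQ; rewrite -frob2_tr trmx_mul trmxK -(frob2_tr A) frob2_compression. Qed.

Lemma frob2_unit_row q (v : 'rV[R]_q) : v != 0 ->
  exists c : R, c *: v *m (c *: v)^T = 1%:M.
Proof.
move=> v0; have v1 : 0 < frob2 v.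
  by rewrite lt_neqAle frob2_ge0 andbT eq_sym; apply: contra_neq v0 => /frob2_eq0.
exists (Num.sqrt (frob2 v))^-1; rewrite linearZ /= -scalemxAr -scalemxAl scalerA.
rewrite -invfM -expr2 sqr_sqrtr ?frob2_ge0 //.
rewrite [v *m _]mx11_scalar -trace_mx11 -frob2E scale_scalar_mx mulVf //.
by rewrite gt_eqF.
Qed.

(** Gram-Schmidt on the rows, one row per induction step. Rank-deficient [A] is allowed: a zero
    residue is replaced by any unit vector orthogonal to the rows of [Q], with diagonal entry 0 in
    [T]. *)
Lemma LQ_factorization k m (A : 'M[R]_(k, m)) : (k <= m)%N ->
  exists (T : 'M[R]_k) (Q : 'M[R]_(k, m)),
    [/\ A = T *m Q, Q *m Q^T = 1%:M & is_trig_mx T].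
Proof.
elim: k A => [|k IH] A km.
  exists 0, A; split; [|apply/matrixP => -[]//|by apply/is_trig_mxP => -[]].
  by apply/matrixP => -[].
have {IH} [T [Q [AE QQ Ttrig]]] :=
  IH (@usubmx R k 1 m (castmx (esym (addn1 k), erefl m) A)) (ltnW km).
set A' := castmx _ A in AE.
pose a := dsubmx A'; pose r := a - (a *m Q^T) *m Q.
have rQ : r *m Q^T = 0 by rewrite mulmxBl -!mulmxA QQ mulmx1 subrr.
have [q [s [rE qq qQ]]] : exists (q : 'rV[R]_m) (s : R),
    [/\ r = s *: q, q *m q^T = 1%:M & q *m Q^T = 0].
  have [r0|r0] := eqVneq r 0.
    have : kermx Q^T != 0.
      rewrite -mxrank_eq0 mxrank_ker subn_eq0 -ltnNge.
      by apply: leq_ltn_trans km; rewrite rank_leq_col.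
    case/rowV0Pn => v /sub_kermxP vQ /frob2_unit_row [c cv].
    exists (c *: v), 0; rewrite scale0r; split=> //.
    by rewrite -scalemxAl vQ scaler0.
  have [c cr] := frob2_unit_row r0.
  exists (c *: r), c^-1; split=> //; last by rewrite -scalemxAl rQ scaler0.
  rewrite scalerA mulVf ?scale1r //.
  apply: contra_eq_neq cr => ->; rewrite scale0r mul0mx; apply/eqP => /matrixP.
  by move=> /(_ 0 0)/eqP; rewrite !mxE eqxx eq_sym oner_eq0.
pose T' := block_mx T 0 (a *m Q^T) (s%:M : 'M_1).
pose Q' := col_mx Q q.
have key : [/\ A' = T' *m Q', Q' *m Q'^T = 1%:M & is_trig_mx T'].
  split.
  - rewrite mul_block_col mul0mx addr0 -AE mul_scalar_mx -rE addrC subrK.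
    by rewrite vsubmxK.
  - rewrite tr_col_mx mul_col_row QQ qq qQ -[Q *m q^T]trmxK trmx_mul trmxK qQ.
    by rewrite trmx0 -scalar_mx_block.
  - by rewrite is_trig_block_mx // eqxx Ttrig mx11_is_trig.
(* Generalizing [k + 1] to a variable makes the equality behind [castmx] destructible. *)
have := key; rewrite /A' => -[]; move: T' Q' {key}; move: (esym (addn1 k)).
move: A {A' a r rQ rE AE} km; move: (k + 1)%N => k1 A km e; case: _ / e => T' Q' AE QQ' tT.
by exists T', Q'; rewrite -AE castmx_id.
Qed.

End Frobenius.

(** * Determinant bounds for products of matrices *)

Section DeterminantBound.
Variable R : realType.

Lemma ler_prod_mean (m : nat) (E : 'I_m -> R) : (forall i, 0 <= E i) ->
  \prod_i E i <= ((\sum_i E i) / m%:R) ^+ m.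
Proof.
move=> E0; have := @leif_AGM R 'I_m predT E (fun i _ => E0 i).
by rewrite /= card_ord => -[].
Qed.

Lemma det_isometry_sqr k (Q : 'M[R]_k) : Q *m Q^T = 1%:M -> \det Q ^+ 2 = 1.
Proof. by move=> QQ; rewrite expr2 -{2}det_tr -det_mulmx QQ det1. Qed.

(** After an LQ factorization the determinant is, up to sign, the product of the diagonal of [T];
    AM-GM applies to the squares of these entries. *)
Lemma det_sqr_le_frob2 k (A : 'M[R]_k) : \det A ^+ 2 <= (frob2 A / k%:R) ^+ k.
Proof.
have [T [Q [-> QQ Ttrig]]] := LQ_factorization A (leqnn k).
rewrite det_mulmx exprMn (det_isometry_sqr QQ) mulr1 frob2_isometry //.
rewrite det_trig // -prodrXl; apply: le_trans (ler_prod_mean _) _.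
  by move=> i; apply: sqr_ge0.
rewrite lerXn2r ?nnegrE ?divr_ge0 ?frob2_ge0 ?ler0n ?sumr_ge0 // => [i _|].
  exact: sqr_ge0.
rewrite ler_wpM2r ?invr_ge0 ?ler0n //; apply: ler_sum => i _.
by rewrite (bigD1 i) //= lerDl sumr_ge0 // => j _; apply: sqr_ge0.
Qed.

(** The divisor [k] is the compressed size, not a dimension of [A]: the factors of the chain are d x
    d, their compressions k x k. *)
Definition mean_frob2 k p q (A : 'M[R]_(p, q)) := frob2 A / k%:R.

Lemma mean_frob2_ge0 k p q (A : 'M[R]_(p, q)) : 0 <= mean_frob2 k A.
Proof. by rewrite divr_ge0 ?frob2_ge0 ?ler0n. Qed.

(** With [A = T *m Q], the square factor [T] splits off the determinant, and [Q] is absorbed into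
    the next matrix, which becomes k x d without growing in norm. The induction continues with it in
    place of [A]. *)
Lemma det_chain_sqr_le k d j (A : 'M[R]_(k, d)) (Wm : nat -> 'M[R]_d)
    (H : 'M[R]_(d, k)) : (k <= d)%N ->
  \det (A *m mid_prod Wm j *m H) ^+ 2 <=
  (mean_frob2 k A * mean_frob2 k H * \prod_(1 <= l < j.+1) mean_frob2 k (Wm l)) ^+ k.
Proof.
move=> kd; elim: j A => [|j IH] A.
  rewrite big_nil mulr1 mulmx1.
  have [T [Q [-> QQ _]]] := LQ_factorization A kd.
  rewrite -mulmxA det_mulmx exprMn exprMn ler_pM ?sqr_ge0 //.
    by rewrite /mean_frob2 (frob2_isometry _ QQ) det_sqr_le_frob2.
  apply: le_trans (det_sqr_le_frob2 _) _.
  rewrite lerXn2r ?nnegrE ?mean_frob2_ge0 // ler_wpM2r ?invr_ge0 ?ler0n //.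
  exact: frob2_compression.
have [T [Q [-> QQ _]]] := LQ_factorization A kd.
rewrite big_nat_recr //= -!mulmxA det_mulmx exprMn.
have -> : mean_frob2 k (T *m Q) = mean_frob2 k T.
  by rewrite /mean_frob2 (frob2_isometry _ QQ).
rewrite -[X in X ^+ k]mulrA [mean_frob2 k H * _]mulrA [_ * mean_frob2 k (Wm _)]mulrC.
rewrite [mean_frob2 k (Wm _) * _]mulrA [leRHS]exprMn.
apply: ler_pM; rewrite ?sqr_ge0 //; first by apply: det_sqr_le_frob2.
rewrite !mulmxA -[Q *m _ *m _ *m H]mulmxA mulmxA; apply: le_trans (IH _) _.
have p0 : 0 <= \prod_(1 <= l < j.+1) mean_frob2 k (Wm l).
  by apply: prodr_ge0 => l _; apply: mean_frob2_ge0.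
rewrite lerXn2r ?nnegrE ?(mean_frob2_ge0, mulr_ge0) //.
do 3?[rewrite ler_wpM2r ?(mean_frob2_ge0, invr_ge0, ler0n) //].
exact: frob2_compression.
Qed.

Lemma det_chain_sqr_le_mean k d j (A : 'M[R]_(k, d)) (Wm : nat -> 'M[R]_d)
    (H : 'M[R]_(d, k)) : (k <= d)%N ->
  \det (A *m mid_prod Wm j *m H) ^+ 2 <=
  ((frob2 H + frob2 A + \sum_(1 <= l < j.+1) frob2 (Wm l)) / (k * j.+2)%:R)
    ^+ (k * j.+2).
Proof.
move=> kd; have := det_chain_sqr_le j A Wm H kd; move/le_trans; apply.
rewrite [(k * _)%N in X in _ <= X]mulnC exprM natrM invfM.
have p0 : 0 <= \prod_(1 <= l < j.+1) mean_frob2 k (Wm l).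
  by apply: prodr_ge0 => l _; apply: mean_frob2_ge0.
have s0 : 0 <= \sum_(1 <= l < j.+1) frob2 (Wm l).
  by apply: sumr_ge0 => l _; apply: frob2_ge0.
have q0 : 0 <= (frob2 H + frob2 A + \sum_(1 <= l < j.+1) frob2 (Wm l)) *
    (j.+2%:R^-1 / k%:R).
  by rewrite mulr_ge0 ?addr_ge0 ?frob2_ge0 // mulr_ge0 ?invr_ge0 ?ler0n.
rewrite lerXn2r ?nnegrE ?(exprn_ge0 _ q0) ?(mean_frob2_ge0, mulr_ge0) //.
(* AM-GM over the [j.+2] factors, ordered from right to left: [H] at index 0, the middle matrices at
   1 to [j], [A] at [j.+1]. *)
pose E (i : 'I_j.+2) : R := if i == 0%N :> nat then mean_frob2 k H
  else if i == j.+1 :> nat then mean_frob2 k A else mean_frob2 k (Wm i).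
have E0 i : 0 <= E i by rewrite /E; do 2?case: ifP => _; rewrite mean_frob2_ge0.
have := ler_prod_mean E0.
have mid (i : 'I_j) : E (lift ord0 (widen_ord (leqnSn _) i)) = mean_frob2 k (Wm i.+1).
  by rewrite /E /= /bump /= eqSS ltn_eqF.
have Emax : E (lift ord0 ord_max) = mean_frob2 k A by rewrite /E /= eqxx.
rewrite big_ord_recl big_ord_recr [\sum_(i < _) _]big_ord_recl [\sum_(i < _) E _]big_ord_recr.
rewrite /= Emax !(eq_bigr _ (fun i _ => mid i)).
rewrite !big_add1 !big_mkord (_ : E ord0 = mean_frob2 k H) //=.
suff -> : mean_frob2 k H + (\sum_(i < j) mean_frob2 k (Wm i.+1) + mean_frob2 k A)
    = (frob2 H + frob2 A + \sum_(i < j) frob2 (Wm i.+1)) / k%:R.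
  rewrite -[_ / k%:R / _]mulrA [k%:R^-1 * _]mulrC; apply: le_trans.
  by rewrite le_eqVlt; apply/orP; left; apply/eqP; ring.
rewrite /mean_frob2 -mulr_suml; ring.
Qed.

End DeterminantBound.

(** * Determinants near the identity and continuity of matrix products *)

Section Perturbation.
Variable R : realType.

Lemma prod_1D_near k : exists2 C : R, 0 <= C &
  forall (e : R) (x : 'I_k -> R), e <= 1 -> (forall i, `|x i| <= e) ->
    `|\prod_i (1 + x i) - (1 + \sum_i x i)| <= C * e ^+ 2.
Proof.
elim: k => [|k [C C0 IH]].
  by exists 0 => // e x _ _; rewrite !big_ord0 addr0 subrr normr0 mul0r.
(* The 2 bounds [1 + x ord0]; the [k%:R] comes from the cross term [s * x ord0]. *)
exists (C * 2 + k%:R); first by rewrite addr_ge0 ?mulr_ge0.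
move=> e x e1 xe; rewrite !big_ord_recl.
have := IH e (fun i => x (lift ord0 i)) e1 (fun i => xe (lift ord0 i)).
set p := \prod_i _; set s := \sum_i _ => hp.
have x0e := xe ord0; have e0 : 0 <= e := le_trans (normr_ge0 _) x0e.
have se : `|s| <= k%:R * e.
  apply: le_trans (ler_norm_sum _ _ _) _.
  apply: le_trans (ler_sum _ (fun i _ => xe (lift ord0 i))) _.
  by rewrite sumr_const card_ord mulr_natl.
have -> : (1 + x ord0) * p - (1 + (x ord0 + s)) =
    (p - (1 + s)) * (1 + x ord0) + s * x ord0 by ring.
apply: le_trans (ler_normD _ _) _; rewrite !normrM mulrDl lerD //.
  rewrite mulrAC ler_pM //; apply: le_trans (ler_normD _ _) _.
  by rewrite normr1 -[2]/(1 + 1) lerD // (le_trans x0e).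
by rewrite expr2 mulrA ler_pM.
Qed.

(** In the Leibniz expansion the identity permutation gives [1 + \tr E] up to second order; every
    other permutation contributes at most [2 ^+ k * e ^+ 2]. *)
Lemma det_1D_ge k : exists2 C : R, 0 <= C &
  forall (e : R) (E : 'M[R]_k), e <= 1 -> (forall i j, `|E i j| <= e) ->
    1 + \tr E - C * e ^+ 2 <= \det (1%:M + E).
Proof.
have [C C0 HC] := prod_1D_near k.
exists (C + \sum_(s : 'S_k | s != 1%g) 2 ^+ k).
  by rewrite addr_ge0 // sumr_ge0 // => s _; rewrite exprn_ge0.
move=> e E e1 Ee; rewrite /determinant [leRHS](bigD1 (1%g : 'S_k)) //=.
rewrite odd_perm1 expr0 mul1r mulrDl opprD addrA.
apply: lerD.
  have := HC e (fun i => E i i) e1 (fun i => Ee i i); rewrite ler_norml => /andP[h _].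
  rewrite (eq_bigr (fun i => 1 + E i i)) => [|i _]; last by rewrite perm1 !mxE eqxx.
  by move: h; rewrite /mxtrace; lra.
rewrite mulr_suml -sumrN; apply: ler_sum => s s1.
apply: lerNnormlW; rewrite normrM normrX normrN1 expr1n mul1r normr_prod.
(* A nonidentity permutation moves both i and s i, which gives two off-diagonal factors. *)
have [i si] : exists i, s i != i.
  apply/existsP; rewrite -negb_forall; apply: contra s1 => /forallP h.
  by apply/eqP/permP => i; rewrite perm1; apply/eqP.
have e0 : 0 <= e := le_trans (normr_ge0 _) (Ee i i).
have off a : s a != a -> `|(1%:M + E) a (s a)| <= e.
  by move=> sa; rewrite !mxE eq_sym (negbTE sa) add0r.
have bnd a b : `|(1%:M + E) a b| <= 2.
  rewrite !mxE; apply: le_trans (ler_normD _ _) _.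
  rewrite -[leRHS]/(1 + 1) lerD ?(le_trans (Ee _ _)) //.
  by case: eqP; rewrite ?normr1 ?normr0.
rewrite (bigD1 i) //= (bigD1 (s i)) //= mulrA [leRHS]mulrC expr2.
rewrite ler_pM ?mulr_ge0 ?prodr_ge0 //.
  by rewrite ler_pM ?off // (inj_eq perm_inj).
rewrite big_mkcond -[in leRHS](card_ord k) -prodr_const.
by apply: ler_prod => a _; case: ifP; rewrite ?normr_ge0 ?bnd ?ler01 // ler1n.
Qed.

(** When the entries are of the order of the trace, the quadratic error is at most
    [C * (M * \tr E) ^+ 2], which a small nonnegative trace absorbs. *)
Lemma det_1D_ge1 k (M : R) : exists2 t0 : R, 0 < t0 &
  forall E : 'M[R]_k, (forall i j, `|E i j| <= M * \tr E) -> 0 <= \tr E <= t0 ->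
    1 <= \det (1%:M + E).
Proof.
have [C C0 HC] := det_1D_ge k.
(* [B] dominates both [M] and [C * M ^+ 2], so a trace at most [B^-1] gives [M * \tr E <= 1] and
   makes the error at most [\tr E]. *)
pose B := 1 + `|M| + C * M ^+ 2.
have CM : 0 <= C * M ^+ 2 by rewrite mulr_ge0 ?sqr_ge0.
have M0 := normr_ge0 M.
have B1 : 1 <= B by rewrite /B; lra.
have B0 : 0 < B by lra.
exists B^-1; first by rewrite invr_gt0.
move=> E EM /andP[t0 tB0]; have tB : \tr E * B <= 1 by rewrite -ler_pdivlMr ?div1r.
have t1 : \tr E * (C * M ^+ 2) <= 1.
  by apply: le_trans tB; rewrite ler_wpM2l // /B; lra.
have t2 : M * \tr E <= 1.
  apply: le_trans tB; rewrite mulrC ler_wpM2l //.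
  by apply: le_trans (ler_norm _) _; rewrite /B; lra.
apply: le_trans (HC _ _ t2 EM); nra.
Qed.

Definition entries_le p q (e : R) (A : 'M[R]_(p, q)) := forall i j, `|A i j| <= e.

Lemma entries_bounded p q (A : 'M[R]_(p, q)) : exists2 M, 0 <= M & entries_le M A.
Proof.
exists (1 + frob2 A); first by rewrite addr_ge0 ?frob2_ge0.
move=> i j; have := sqr_le_frob2 A i j; rewrite -real_normK ?num_real //.
have := normr_ge0 (A i j); nra.
Qed.

Lemma entries_le_frob2 p q (e : R) (A : 'M[R]_(p, q)) : 0 < e ->
  frob2 A < e ^+ 2 -> entries_le e A.
Proof.
move=> e0 Ae i j; have := le_lt_trans (sqr_le_frob2 A i j) Ae.
by rewrite -real_normK ?num_real // ltr_pXn2r ?nnegrE ?(ltW e0) // => /ltW.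
Qed.

Lemma entries_leM p q r (a b : R) (A : 'M[R]_(p, q)) (B : 'M[R]_(q, r)) :
  entries_le a A -> entries_le b B -> entries_le (q%:R * (a * b)) (A *m B).
Proof.
move=> hA hB i j; rewrite mxE; apply: le_trans (ler_norm_sum _ _ _) _.
apply: le_trans (_ : _ <= \sum_(l < q) a * b) _.
  by apply: ler_sum => l _; rewrite normrM ler_pM.
by rewrite sumr_const card_ord mulr_natl.
Qed.

Lemma mulmx_continuous p q r (A : 'M[R]_(p, q)) (B : 'M[R]_(q, r)) (e : R) :
  0 < e -> exists2 t : R, 0 < t & forall A' B',
    entries_le t (A' - A) -> entries_le t (B' - B) ->
    entries_le e (A' *m B' - A *m B).
Proof.
move=> e0; have [a a0 hA] := entries_bounded A; have [b b0 hB] := entries_bounded B.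
(* For [t = e / D], the summand [e] in [D] ensures [t <= 1], and then [q * (a * t + t * b + t * t)]
   is at most [t * D = e]. *)
pose D := q%:R * (a + b + 1) + e + 1.
have q0 : 0 <= q%:R :> R := ler0n _ _.
have D0 : 0 < D by rewrite /D; nra.
exists (e / D) => [|A' B' hA' hB'].
  by rewrite divr_gt0.
have t0 : 0 < e / D by rewrite divr_gt0.
have tD : e / D * D = e by rewrite mulfVK ?gt_eqF.
have t1 : e / D <= 1 by rewrite ler_pdivrMr // /D; nra.
have -> : A' *m B' - A *m B = A *m (B' - B) + (A' - A) *m B + (A' - A) *m (B' - B).
  by rewrite !mulmxBl !mulmxBr; apply/matrixP => i j; rewrite !mxE; ring.
move=> i j; rewrite mxE [X in `|X + _|]mxE.
have := entries_leM hA hB' i j; have := entries_leM hA' hB i j.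
have := entries_leM hA' hB' i j.
move: (e / D) t0 tD t1 {hA' hB'} => t t0 tD t1 h1 h2 h3.
apply: le_trans (ler_normD _ _) _; apply: le_trans (lerD (ler_normD _ _) (lexx _)) _.
have h4 : q%:R * (t * t) <= q%:R * t by rewrite ler_wpM2l // ler_piMr // ltW.
have h5 : 0 <= t * e by rewrite mulr_ge0 // ltW.
rewrite -tD /D; move: `|_| h1 => x1 h1; move: `|_| h2 => x2 h2; move: `|_| h3 => x3 h3.
clear - x1 x2 x3 h1 h2 h3 h4 h5 t0; rewrite !mulrDr mulr1; lra.
Qed.

End Perturbation.

(** * Indexing of columns by class and sample *)

Section Columns.
Variables (R : realType) (K n : nat).

Lemma cls_proof (j : 'I_(K * n)) : (j %/ n < K)%N.
Proof.
have n0 : (0 < n)%N by case: (n) j => // -[j]; rewrite muln0.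
by rewrite ltn_divLR.
Qed.

Definition cls (j : 'I_(K * n)) : 'I_K := Ordinal (cls_proof j).

Lemma cls_col_idx c i : cls (col_idx c i) = c.
Proof.
have n0 : (0 < n)%N by apply: leq_ltn_trans (ltn_ord i).
by apply: val_inj; rewrite /= divnMDl // divn_small ?addn0.
Qed.

Lemma col_idx_surj (j : 'I_(K * n)) : exists i, j = col_idx (cls j) i.
Proof.
have n0 : (0 < n)%N by case: (n) j => // -[j]; rewrite muln0.
by exists (Ordinal (ltn_pmod j n0)); apply: val_inj; rewrite /= -divn_eq.
Qed.

Lemma col_idx_inj : injective (fun p : 'I_K * 'I_n => col_idx p.1 p.2).
Proof.
move=> [c i] [c' i'] /= e; have := congr1 cls e; rewrite !cls_col_idx => cc.
by congr pair => //; apply: val_inj; move: e; rewrite cc => -[] /addnI.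
Qed.

Lemma sum_col_idx (F : 'I_(K * n) -> R) :
  \sum_j F j = \sum_c \sum_i F (col_idx c i).
Proof.
rewrite pair_bigA /= (reindex (fun p : 'I_K * 'I_n => col_idx p.1 p.2)) //=.
apply: onW_bij; apply: inj_card_bij; first exact: col_idx_inj.
by rewrite card_prod !card_ord.
Qed.

Lemma sum_cls (F : 'I_K -> R) : \sum_(j < K * n) F (cls j) = n%:R * \sum_c F c.
Proof.
rewrite sum_col_idx mulr_sumr; apply: eq_bigr => c _.
rewrite (eq_bigr (fun=> F c)) => [|i _]; last by rewrite cls_col_idx.
by rewrite sumr_const card_ord mulr_natl.
Qed.

End Columns.

(** * Powers and roots of positive semidefinite matrices *)

Section PSDPowers.
Variable R : realType.

Lemma mxexpS p (G : 'M[R]_p) m : G ^+ m.+1 = G *m G ^+ m.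
Proof. exact: exprS. Qed.

Lemma mxexpSr p (G : 'M[R]_p) m : G ^+ m.+1 = G ^+ m *m G.
Proof. exact: exprSr. Qed.

Lemma mxexpD p (G : 'M[R]_p) a b : G ^+ (a + b) = G ^+ a *m G ^+ b.
Proof. exact: exprD. Qed.

(** If [G ^+ m.+2] kills [X], then [Y = G ^+ m.+1 *m X] has [Y^T *m Y = X^T *m G ^+ m *m G ^+ m.+2
    *m X = 0]; so the exponent can be lowered to 1. *)
Lemma sym_pow_ker p q (G : 'M[R]_p) (X : 'M[R]_(p, q)) m :
  G^T = G -> G ^+ m.+1 *m X = 0 -> G *m X = 0.
Proof.
move=> GT; elim: m => [|m IH]; first by rewrite expr1.
move=> GX; apply/IH/mulTmx_eq0.
have powT r : (G ^+ r)^T = G ^+ r.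
  elim: r => [|r IHr]; first by rewrite !expr0 trmx1.
  by rewrite [in LHS]mxexpS trmx_mul IHr GT -mxexpSr.
rewrite trmx_mul powT -mulmxA; rewrite [G ^+ m.+1 *m (_ *m _)]mulmxA -mxexpD.
by rewrite addSnnS mxexpD -[_ *m _ *m X]mulmxA GX !mulmx0.
Qed.

(** Moving one [G] into each copy of [X] lowers the exponent by two; exponents 0 and 1 give squared
    Frobenius norms. *)
Lemma trace_psd_pow_ge0 p q r (W : 'M[R]_(p, q)) (X : 'M[R]_(p, r)) m :
  0 <= \tr (X^T *m (W *m W^T) ^+ m *m X).
Proof.
set G := W *m W^T; have GT : G^T = G by rewrite trmx_mul trmxK.
elim/ltn_ind: m X => -[|[|m]] IH X.
- by rewrite expr0 mulmx1 mxtrace_mulC -frob2E frob2_ge0.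
- rewrite expr1 mulmxA -mulmxA -[X^T *m W]trmxK trmx_mul trmxK.
  by rewrite mxtrace_mulC -frob2E frob2_ge0.
have := IH m (leqnSn _) (G *m X); rewrite trmx_mul GT.
by rewrite mxexpS mxexpSr !mulmxA.
Qed.

(** Uniqueness of positive semidefinite roots, for multiples of a projection. It recovers the Gram
    matrix of [WL] from that of the logits. *)
Lemma psd_root_of_projection p q (W : 'M[R]_(p, q)) (S : 'M[R]_p) (lam : R) m :
  0 < lam -> S^T = S -> S *m S = S -> (W *m W^T) ^+ m.+1 = lam ^+ m.+1 *: S ->
  W *m W^T = lam *: S.
Proof.
move=> lam0 ST SS; set G := W *m W^T => Gm.
have GT : G^T = G by rewrite trmx_mul trmxK.
(* [G ^+ m.+1] kills [1 - S], hence so does [G]. *)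
have GS : G *m S = G.
  apply/eqP; rewrite eq_sym -subr_eq0 -{1}[G]mulmx1 -mulmxBr; apply/eqP.
  by apply: (@sym_pow_ker _ _ _ _ m) => //; rewrite Gm -scalemxAl mulmxBr mulmx1 SS subrr scaler0.
have SG : S *m G = G by rewrite -[LHS]trmxK trmx_mul GT ST GS GT.
(* D = G - lam S is killed by the sum of the G^(m-i) (lam S)^i, which is positive definite on the
   image of S. *)
set D := G - lam *: S.
have DT : D^T = D by rewrite /D linearB linearZ /= GT ST.
have SD : S *m D = D by rewrite /D mulmxBr SG -scalemxAr SS.
have SDi i : (lam *: S) ^+ i *m D = lam ^+ i *: D.
  elim: i => [|i IH]; first by rewrite !expr0 mul1mx scale1r.
  by rewrite mxexpS -mulmxA IH -scalemxAr -scalemxAl SD scalerA -exprSr.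
have cGS : GRing.comm G (lam *: S).
  rewrite /GRing.comm.
  by change (G *m (lam *: S) = lam *: S *m G); rewrite -scalemxAl -scalemxAr GS SG.
have lS i : (lam *: S) ^+ i.+1 = lam ^+ i.+1 *: S.
  elim: i => [|i IH]; first by rewrite !expr1.
  by rewrite mxexpS IH -scalemxAl -scalemxAr scalerA SS -exprS.
have D0 : 0 = D *m \sum_(i < m.+1) G ^+ (m - i) *m (lam *: S) ^+ i.
  by have := subrXX_comm m.+1 cGS; rewrite Gm lS subrr.
have s0 : \sum_(i < m.+1) lam ^+ i * \tr (D^T *m G ^+ (m - i) *m D) = 0.
  transitivity (\tr (0 *m D)); last by rewrite mul0mx mxtrace0.
  rewrite D0 mulmx_sumr mulmx_suml raddf_sum; apply: eq_bigr => i _ /=.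
  by rewrite -!mulmxA SDi -!scalemxAr linearZ /= DT !mulmxA.
have D2 : \tr (D^T *m D) = 0.
  suff /eqP : lam ^+ m * \tr (D^T *m D) = 0.
    by rewrite mulf_eq0 expf_eq0 (gt_eqF lam0) andbF => /eqP.
  have t0 : 0 <= \tr (D^T *m D) by rewrite mxtrace_mulC -frob2E frob2_ge0.
  apply/eqP; rewrite eq_le mulr_ge0 ?exprn_ge0 ?(ltW lam0) // andbT.
  (* The term [i = m] of the vanishing sum is [lam ^+ m * \tr (D^T *m D)]; the others are
     nonnegative. *)
  rewrite -[leRHS]s0 big_ord_recr /= subnn expr0 mulmx1 lerDr sumr_ge0 // => i _.
  by rewrite mulr_ge0 ?trace_psd_pow_ge0 // exprn_ge0 // ltW.
apply/eqP; rewrite -subr_eq0; apply/eqP/frob2_eq0.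
by rewrite frob2E mxtrace_mulC.
Qed.

End PSDPowers.

(** * The simplex matrix as an orthogonal projection *)

Section Simplex.
Variables (R : realType) (K : nat).
Hypothesis K0 : (0 < K)%N.
Local Notation S := (simplexETF R K).

Lemma simplexE i j : S i j = (i == j)%:R - K%:R^-1.
Proof. by rewrite !mxE mulr1. Qed.

Lemma simplex_tr : S^T = S.
Proof. by apply/matrixP => i j; rewrite mxE !simplexE eq_sym. Qed.

Lemma mul_const1_simplex : (const_mx 1 : 'rV[R]_K) *m S = 0.
Proof.
apply/matrixP => i j; rewrite !mxE.
rewrite (eq_bigr (fun k => (k == j)%:R - K%:R^-1)) => [|k _]; last first.
  by rewrite simplexE mxE mul1r.
rewrite sumrB sumr_const card_ord -[K%:R^-1 *+ _]mulr_natl mulfV ?pnatr_eq0 -?lt0n //.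
rewrite (bigD1 j) //= eqxx big1 ?addr0 ?subrr // => k /negbTE -> //.
Qed.

Lemma simplex_idem : S *m S = S.
Proof.
rewrite {1}/simplexETF mulmxBl mul1mx -scalemxAl.
suff -> : (const_mx 1 : 'M[R]_K) *m S = 0 by rewrite scaler0 subr0.
apply/row_matrixP => i; rewrite row_mul row_const mul_const1_simplex.
by rewrite row0.
Qed.

Lemma simplex_trace : \tr S = K%:R - 1.
Proof.
rewrite /mxtrace (eq_bigr (fun=> 1 - K%:R^-1)) => [|i _]; last by rewrite simplexE eqxx.
by rewrite sumr_const card_ord -[_ *+ K]mulr_natl mulrBr mulr1 mulfV // pnatr_eq0 -lt0n.
Qed.

Lemma simplex_margin (c c' : 'I_K) : c' != c -> S c c - S c' c = 1.
Proof. by move=> /negbTE cc; rewrite !simplexE eqxx cc; rewrite opprB addrA subrK subr0. Qed.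

End Simplex.

(** * Gram matrices and objective value at a DNC point *)

Section DNCPoint.
Variables (R : realType) (K n d L : nat).
Hypotheses (K0 : (0 < K)%N) (L0 : (0 < L)%N).
Variables (WL : 'M[R]_(K, d)) (Wm : nat -> 'M[R]_d) (H1 : 'M[R]_(d, K * n)).
Hypothesis dnc : DNC_point L WL Wm H1.
Local Notation S := (simplexETF R K).
Local Notation Z := (logits L WL Wm H1).

Lemma DNC_logitsE c j : Z c j = S c (cls j).
Proof. by have [i ->] := col_idx_surj j; rewrite cls_col_idx; apply: (proj2 dnc). Qed.

Lemma DNC_logits_gram : Z *m Z^T = n%:R *: S.
Proof.
apply/matrixP => a b; rewrite [LHS]mxE [RHS]mxE.
rewrite (eq_bigr (fun j => (fun c => S a c * S b c) (cls j))) => [|j _]; last first.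
  by rewrite [Z^T _ _]mxE !DNC_logitsE.
rewrite (sum_cls n (fun c => S a c * S b c)) -[in RHS](simplex_idem R K0) mxE; congr (_ * _).
by apply: eq_bigr => c _; rewrite [S c b]simplexE [S b c]simplexE eq_sym.
Qed.

Lemma simplex_mul_DNC_logits : S *m Z = Z.
Proof.
apply/matrixP => a j; rewrite DNC_logitsE -[in RHS](simplex_idem R K0) !mxE.
by apply: eq_bigr => c _; rewrite DNC_logitsE.
Qed.

(** Balancedness replaces the inner Gram matrix by [W^T *m W] for the next factor [W], and
    [W (W^T W)^p W^T = (W W^T)^(p+1)]. *)
Lemma balanced_tail_gram j : (j < L)%N ->
  (mid_prod Wm j *m H1) *m (mid_prod Wm j *m H1)^T = gram_right Wm H1 j.+1 ^+ j.+1.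
Proof.
elim: j => [|j IH] jL; first by rewrite /= mul1mx expr1.
have bal : gram_right Wm H1 j.+1 = (Wm j.+1)^T *m Wm j.+1.
  by rewrite -(proj1 dnc) 1?(ltnW jL) // /gram_left ltn_eqF.
rewrite [in RHS]/gram_right /=; move: (IH (ltnW jL)); rewrite {}bal => {}IH.
rewrite -[_ *m _ *m H1]mulmxA trmx_mul [LHS]mulmxA -[Wm _ *m _ *m _]mulmxA IH.
move: {IH} (Wm j.+1) => W; elim: (j.+1) => [|p IH]; first by rewrite mulmx1 expr1.
by rewrite mxexpS mxexpS -IH !mulmxA.
Qed.

Lemma balanced_logits_gram : Z *m Z^T = (WL *m WL^T) ^+ L.+1.
Proof.
have L1 : (L.-1 < L)%N by rewrite prednK.
have := balanced_tail_gram L1; rewrite prednK // -(proj1 dnc) ?L0 ?leqnn //.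
rewrite /gram_left eqxx => e.
rewrite /logits -(mulmxA WL (mid_prod Wm L.-1) H1) trmx_mul [LHS]mulmxA.
rewrite -[WL *m _ *m _]mulmxA e.
elim: (L) => [|p IH]; first by rewrite mulmx1 expr1.
by rewrite mxexpS mxexpS -IH !mulmxA.
Qed.

(** Traces of the balancedness relations show that all [L.+1] factors have equal Frobenius norm. *)
Lemma balanced_objective : objective L WL Wm H1 = L.+1%:R * frob2 WL.
Proof.
pose a l := if l == 0%N then frob2 H1 else if l == L then frob2 WL else frob2 (Wm l).
have aS l : (l < L)%N -> a l.+1 = a l.
  move=> lL; have := congr1 mxtrace ((proj1 dnc) l.+1 lL).
  rewrite /gram_left /gram_right /a /= eqSS (ltn_eqF lL).
  by do 2?case: ifP => _; rewrite [LHS]mxtrace_mulC -!frob2E.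
have aL l : (l <= L)%N -> a l = frob2 WL.
  move=> lL; suff aux m : (l <= m <= L)%N -> a m = a l.
    by rewrite -(aux L) ?lL ?leqnn // /a eqxx gtn_eqF.
  elim: m => [|m IH]; first by rewrite leqn0 andbC => /andP[_ /eqP ->].
  rewrite leq_eqVlt => /andP[/orP[/eqP -> //|lm] mL].
  by rewrite aS // IH // -ltnS lm ltnW.
rewrite /objective (_ : frob2 H1 = a 0%N) // aL //.
rewrite (eq_big_nat _ _ (F2 := fun=> frob2 WL)) => [|l /andP[l0 lL]]; last first.
  by rewrite -(aL l) 1?ltnW // /a gtn_eqF // ltn_eqF.
rewrite sumr_const_nat -mulr_natl; case: (L) L0 => // m _.
by rewrite subn1 /= -!natr1; ring.
Qed.

(** [(WL *m WL^T) ^+ L.+1 = n S = lam ^+ L.+1 *: S] forces [WL *m WL^T = lam *: S], whose trace is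
    [lam * (K - 1)]. *)
Lemma DNC_objective lam : 0 < lam -> lam ^+ L.+1 = n%:R ->
  objective L WL Wm H1 = L.+1%:R * (lam * (K%:R - 1)).
Proof.
move=> lam0 lamn; rewrite balanced_objective frob2E.
rewrite (psd_root_of_projection lam0 (simplex_tr R K) (simplex_idem R K0) (m := L)).
  by rewrite linearZ /= simplex_trace.
by rewrite -balanced_logits_gram DNC_logits_gram lamn.
Qed.

End DNCPoint.

(** * Continuity of the logits in the parameters *)

Section Continuity.
Variables (R : realType) (K n d : nat).

Lemma entries_leW p q (a b : R) (A : 'M[R]_(p, q)) :
  a <= b -> entries_le a A -> entries_le b A.
Proof. by move=> ab h i j; apply: le_trans ab. Qed.

Lemma mid_prod_continuous (Wm : nat -> 'M[R]_d) j (e : R) : 0 < e ->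
  exists2 t : R, 0 < t & forall Wm' : nat -> 'M[R]_d,
    (forall l, (1 <= l <= j)%N -> entries_le t (Wm' l - Wm l)) ->
    entries_le e (mid_prod Wm' j - mid_prod Wm j).
Proof.
elim: j e => [|j IH] e e0.
  by exists 1 => // Wm' _ a b; rewrite subrr mxE normr0 ltW.
have [t t0 ht] := mulmx_continuous (Wm j.+1) (mid_prod Wm j) e0.
have [s s0 hs] := IH t t0.
exists (Num.min s t) => [|Wm' h]; first by rewrite lt_min s0 t0.
apply: ht.
  by apply: entries_leW (h _ _); rewrite ?ge_min ?lexx ?orbT ?leqnn.
apply: hs => l /andP[l1 lj]; apply: entries_leW (h _ _).
  by rewrite ge_min lexx.
by rewrite l1 ltnW.
Qed.

Lemma logits_continuous L (WL : 'M[R]_(K, d)) Wm (H1 : 'M[R]_(d, K * n)) (e : R) :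
  0 < e -> exists2 t : R, 0 < t & forall WL' Wm' H1',
    param_dist L WL WL' Wm Wm' H1 H1' < t ->
    entries_le e (logits L WL' Wm' H1' - logits L WL Wm H1).
Proof.
move=> e0.
have [t1 t10 h1] := mulmx_continuous (WL *m mid_prod Wm L.-1) H1 e0.
have [t2 t20 h2] := mulmx_continuous WL (mid_prod Wm L.-1) t10.
have [t3 t30 h3] := mid_prod_continuous Wm L.-1 t20.
pose t := Num.min t1 (Num.min t2 t3).
have t0 : 0 < t by rewrite !lt_min t10 t20 t30.
(* [param_dist] sums squared norms, so entrywise closeness [t] needs the radius [t ^+ 2]. *)
exists (t ^+ 2) => [|WL' Wm' H1' dist]; first by rewrite exprn_gt0.
have frobC p q (A B : 'M[R]_(p, q)) : frob2 (B - A) = frob2 (A - B).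
  by rewrite -opprB /frob2; do 2!apply: eq_bigr => ? _; rewrite mxE sqrrN.
have sum0 (r : seq nat) P : 0 <= \sum_(l <- r | P l) frob2 (Wm l - Wm' l).
  by apply: sumr_ge0 => l _; apply: frob2_ge0.
have dW := frob2_ge0 (WL - WL'); have dH := frob2_ge0 (H1 - H1').
have close p q (A B : 'M[R]_(p, q)) :
    frob2 (A - B) <= param_dist L WL WL' Wm Wm' H1 H1' -> entries_le t (B - A).
  by move=> AB; apply: entries_le_frob2 => //; rewrite frobC; apply: le_lt_trans dist.
apply: h1; last first.
  apply: entries_leW (close _ _ _ _ _); first by rewrite ge_min lexx.
  rewrite /param_dist; have := sum0 (index_iota 1 L) predT; lra.
apply: h2.
  apply: entries_leW (close _ _ _ _ _); first by rewrite !ge_min lexx orbT.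
  rewrite /param_dist; have := sum0 (index_iota 1 L) predT; lra.
apply: h3 => l /andP[l1 lL].
apply: entries_leW (close _ _ _ _ _); first by rewrite !ge_min lexx !orbT.
have lin : l \in index_iota 1 L by rewrite mem_index_iota l1; case: (L) lL l1 => //; case: l.
rewrite /param_dist (bigD1_seq l) ?iota_uniq //=.
have := sum0 (index_iota 1 L) (fun i => i != l); lra.
Qed.

End Continuity.

(** * Feasible perturbations of a DNC point *)

Section LocalMinimum.
Variable R : realType.

(** In an LQ factorization of the all-ones matrix, triangularity makes the first row [u] of [Q]
    constant. The other rows form [U], and [Q^T *m Q = 1] gives [U^T *m U = 1 - u^T *m u]. *)
Lemma simplex_basis k : exists U : 'M[R]_(k, k.+1),
  U *m U^T = 1%:M /\ U^T *m U = simplexETF R k.+1.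
Proof.
have [T [Q [TQ QQ Ttrig]]] := LQ_factorization (const_mx 1 : 'M[R]_(1 + k)) (leqnn _).
pose u := usubmx Q; pose U := dsubmx Q.
have QE : Q = col_mx u U by rewrite vsubmxK.
have uc j : T 0 0 * u 0 j = 1.
  move/matrixP: TQ => /(_ 0 j); rewrite mxE mxE (bigD1 0) //= big1 => [|i i0].
    by rewrite addr0 mxE => ->; congr (_ * Q _ _); apply: val_inj.
  by rewrite (is_trig_mxP Ttrig) ?mul0r // lt0n.
have := QQ; rewrite QE tr_col_mx mul_col_row scalar_mx_block.
move=> /eq_block_mx[uu _ _ UU]; exists U; split=> //.
have := mulmx1C QQ; rewrite QE tr_col_mx mul_row_col => /eqP.
rewrite eq_sym addrC -subr_eq => /eqP <-; congr (_ - _).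
have T0 : T 0 0 != 0.
  by apply/eqP => T0; have := uc 0; rewrite T0 mul0r => /esym/eqP; rewrite oner_eq0.
have ui j : u 0 j = (T 0 0)^-1 by apply: (mulfI T0); rewrite uc mulfV.
have c2 : (T 0 0)^-1 ^+ 2 = k.+1%:R^-1.
  have := congr1 mxtrace uu; rewrite mxtrace1 -frob2E /frob2 big_ord1.
  rewrite (eq_bigr (fun=> (T 0 0)^-1 ^+ 2)) => [|j _]; last by rewrite ui.
  rewrite sumr_const card_ord -[LHS]mulr_natr => h.
  by apply: (mulIf (x := k.+1%:R)); rewrite ?pnatr_eq0 // h mulVf ?pnatr_eq0.
by apply/matrixP => i j; rewrite !mxE big_ord1 mxE !ui mulr1 -expr2 c2.
Qed.

Variables (k n d L : nat).
Hypotheses (n0 : (0 < n)%N) (L0 : (0 < L)%N) (kd : (k.+1 <= d)%N).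
Variables (WL : 'M[R]_(k.+1, d)) (Wm : nat -> 'M[R]_d) (H1 : 'M[R]_(d, k.+1 * n)).
Hypothesis dnc : DNC_point L WL Wm H1.
Variables (WL' : 'M[R]_(k.+1, d)) (Wm' : nat -> 'M[R]_d) (H1' : 'M[R]_(d, k.+1 * n)).
Hypothesis feas : feasible L WL' Wm' H1'.
Variable U : 'M[R]_(k, k.+1).
Hypotheses (UU : U *m U^T = 1%:M) (UTU : U^T *m U = simplexETF R k.+1).
Local Notation S := (simplexETF R k.+1).
Local Notation Z := (logits L WL Wm H1).
Local Notation Z' := (logits L WL' Wm' H1').

(** The matrix E with [U Z' V^T = sqrt n (1 + E)], where [V = U Z / sqrt n]. *)
Definition deviation : 'M[R]_k := n%:R^-1 *: (U *m (Z' - Z) *m (U *m Z)^T).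

(** As the constraints are tight at [Z], this is the margin of [Z'] minus 1 when [c] is not the
    class of [j], and 0 when it is. *)
Definition slack c j := (Z' - Z) (cls j) j - (Z' - Z) c j.

Lemma slack_ge0 c j : 0 <= slack c j.
Proof.
have [->|cj] := eqVneq c (cls j); first by rewrite /slack subrr.
have [i ji] := col_idx_surj j.
have := feas i cj; rewrite -ji => f.
have := simplex_margin R cj; rewrite -!(DNC_logitsE dnc) /slack.
have sub c1 : (Z' - Z) c1 j = Z' c1 j - Z c1 j by rewrite mxE [X in _ + X]mxE.
rewrite !sub; lra.
Qed.

(** Cyclicity and [S *m Z = Z] turn the trace into the inner product of [Z' - Z] and [Z], divided by
    [n]. Column [j] of [Z] is a unit vector minus the mean, so it pairs to the average slack over
    [c]. *)
Lemma trace_deviation :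
  \tr deviation = (n%:R * k.+1%:R)^-1 * \sum_j \sum_c slack c j.
Proof.
rewrite /deviation linearZ /= invfM -mulrA; congr (_ * _).
rewrite trmx_mul mulmxA mxtrace_mulC !mulmxA UTU.
rewrite mxtrace_mulC mulmxA -{1}(simplex_tr R k.+1) -trmx_mul simplex_mul_DNC_logits //.
rewrite /mxtrace mulr_sumr; apply: eq_bigr => j _; rewrite mxE.
rewrite (eq_bigr (fun c => (c == cls j)%:R * (Z' - Z) c j - k.+1%:R^-1 * (Z' - Z) c j)); last first.
  by move=> c _; rewrite mxE (DNC_logitsE dnc) simplexE mulrBl.
rewrite sumrB (bigD1 (cls j)) //= eqxx mul1r big1 ?addr0 => [|c /negbTE ->]; last first.
  by rewrite mul0r.
rewrite /slack sumrB sumr_const card_ord -[X in _ * (X - _)]mulr_natl mulrBr mulKf ?pnatr_eq0 //.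
by rewrite mulr_sumr.
Qed.

(** The rows of [U] sum to 0, so column [j] of [U *m (Z' - Z)] is [-U] applied to the slacks. The
    entries of [U] and [U *m Z] are at most 1 in modulus, and nonnegative slacks are controlled by
    their sum, that is by the trace. *)
Lemma deviation_le a b : `|deviation a b| <= k.+1%:R * \tr deviation.
Proof.
have U1 a' c : `|U a' c| <= 1.
  rewrite -(ler_pXn2r (n := 2)) ?nnegrE // expr1n real_normK ?num_real //.
  have <- : (U *m U^T) a' a' = 1 by rewrite UU mxE eqxx.
  rewrite mxE (bigD1 c) //= mxE -expr2 lerDl sumr_ge0 // => i _.
  by rewrite mxE -expr2 sqr_ge0.
have US : U *m S = U by rewrite -UTU mulmxA UU mul1mx.
have U0 a' : \sum_c U a' c = 0.
  have : (U *m S) *m (const_mx 1 : 'cV_k.+1) = 0.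
    rewrite -mulmxA; have := mul_const1_simplex R (isT : 0 < k.+1)%N.
    by move/(congr1 trmx); rewrite trmx_mul trmx_const simplex_tr trmx0 => ->; rewrite mulmx0.
  rewrite US => /matrixP/(_ a' 0); rewrite !mxE => h; rewrite -[RHS]h.
  by apply: eq_bigr => c _; rewrite mxE mulr1.
have -> : k.+1%:R * \tr deviation = n%:R^-1 * \sum_j \sum_c slack c j.
  by rewrite trace_deviation invfM mulrA mulrCA mulfV ?pnatr_eq0 // mulr1.
rewrite /deviation mxE normrM ger0_norm ?invr_ge0 // ler_wpM2l ?invr_ge0 //.
rewrite mxE; apply: le_trans (ler_norm_sum _ _ _) (ler_sum _ _) => j _.
have UZ : `|(U *m Z)^T j b| <= 1.
  rewrite mxE [X in `|X|]mxE (eq_bigr (fun c => U b c * S c (cls j))) => [|c _]; last first.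
    by rewrite (DNC_logitsE dnc).
  by have -> : \sum_c U b c * S c (cls j) = U b (cls j) by rewrite -[in RHS]US mxE.
have UD : `|(U *m (Z' - Z)) a j| <= \sum_c slack c j.
  have -> : (U *m (Z' - Z)) a j = - \sum_c U a c * slack c j.
    have e : \sum_c U a c * (Z' - Z) (cls j) j = 0 by rewrite -mulr_suml U0 mul0r.
    rewrite mxE /slack -[LHS]subr0 -[X in _ - X]e.
    by rewrite -sumrB -sumrN; apply: eq_bigr => c _; rewrite mulrBr opprB.
  rewrite normrN; apply: le_trans (ler_norm_sum _ _ _) (ler_sum _ _) => c _.
  by rewrite normrM (ger0_norm (slack_ge0 c j)) ler_piMl ?slack_ge0.
by rewrite normrM -[leRHS]mulr1 ler_pM.
Qed.

(** The chain bound for [U Z' V^T]: compressing [WL'] by [U] and [H1'] by [V] does not increase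
    their norms, and [n ^+ k] is the square of the scalar [s ^+ k] in the determinant. *)
Lemma det_deviation_le :
  n%:R ^+ k * \det (1%:M + deviation) ^+ 2 <=
  (objective L WL' Wm' H1' / (k * L.+1)%:R) ^+ (k * L.+1).
Proof.
have nn : 0 <= n%:R :> R by [].
have nz : n%:R != 0 :> R by rewrite pnatr_eq0 -lt0n.
set s := Num.sqrt n%:R : R; have ss : s ^+ 2 = n%:R by rewrite sqr_sqrtr.
have sz : s != 0 by rewrite -sqrf_eq0 ss.
pose V := s^-1 *: (U *m Z).
have UZZU : U *m Z *m (U *m Z)^T = n%:R%:M.
  rewrite trmx_mul mulmxA -(mulmxA U) DNC_logits_gram // -UTU -scalemxAr -scalemxAl.
  by rewrite mulmxA UU mul1mx UU scalemx1.
have VV : V *m V^T = 1%:M.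
  rewrite /V linearZ /= -scalemxAl -scalemxAr UZZU scalerA -invfM -expr2 ss.
  by rewrite scale_scalar_mx mulVf.
have PE : s *: (1%:M + deviation) = (U *m WL') *m mid_prod Wm' L.-1 *m (H1' *m V^T).
  have -> : (U *m WL') *m mid_prod Wm' L.-1 *m (H1' *m V^T) = U *m Z' *m V^T.
    by rewrite /logits !mulmxA.
  rewrite /V linearZ /= -scalemxAr.
  have -> : U *m Z' *m (U *m Z)^T = n%:R *: (1%:M + deviation).
    rewrite scalerDr /deviation scalerA mulfV // scale1r scalemx1 -UZZU.
    by rewrite -mulmxDl -mulmxDr addrC subrK.
  by rewrite scalerA -ss expr2 mulKf.
have := det_chain_sqr_le_mean L.-1 (U *m WL') Wm' (H1' *m V^T) (ltnW kd).
rewrite -PE detZ exprMn -exprM mulnC exprM ss prednK // => /le_trans; apply.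
have s0 : 0 <= \sum_(1 <= l < L) frob2 (Wm' l).
  by apply: sumr_ge0 => l _; apply: frob2_ge0.
rewrite lerXn2r ?nnegrE ?divr_ge0 ?addr_ge0 ?frob2_ge0 //.
rewrite ler_wpM2r ?invr_ge0 // lerD2r lerD //.
  exact: frob2_compressionr.
exact: frob2_compression.
Qed.

End LocalMinimum.

(** * Local minimality *)

Section LocalMinimumTheorem.
Variable R : realType.

Lemma exists_nth_root (m : nat) (c : R) : 0 <= c ->
  exists2 x : R, 0 <= x & x ^+ m.+1 = c.
Proof.
move=> c0; pose p : {poly R} := 'X^(m.+1) - c%:P.
have pE x : p.[x] = x ^+ m.+1 - c by rewrite !hornerE.
have c1 : 0 <= 1 + c by rewrite addr_ge0.
have [|x /andP[x0 _]] := @poly_ivt R p 0 (1 + c) c1.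
  rewrite !pE expr0n sub0r oppr_le0 c0 /= subr_ge0.
  apply: le_trans (_ : 1 + c <= _); first by rewrite lerDr.
  by rewrite exprS ler_peMr // exprn_ege1 // lerDl.
by rewrite /root pE subr_eq0 => /eqP xc; exists x.
Qed.

(** Since [n = lam ^+ L.+1] and the determinant is at least 1, the bound reads [lam ^+ (k * L.+1) <=
    (objective / (k * L.+1)) ^+ (k * L.+1)]; taking roots gives exactly the DNC value. *)
Lemma DNC_local_min (k n d L : nat) (WL : 'M[R]_(k.+1, d)) Wm (H1 : 'M[R]_(d, k.+1 * n)) :
  (0 < k)%N -> (0 < n)%N -> (0 < L)%N -> (k < d)%N -> DNC_point L WL Wm H1 ->
  exists2 eps : R, 0 < eps & forall WL' Wm' H1',
    param_dist L WL WL' Wm Wm' H1 H1' < eps -> feasible L WL' Wm' H1' ->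
    objective L WL Wm H1 <= objective L WL' Wm' H1'.
Proof.
move=> k0 n0 L0 kd dnc.
have [lam lam_ge0 lamn] := @exists_nth_root L n%:R (ler0n _ _).
have lam0 : 0 < lam.
  rewrite lt_neqAle lam_ge0 andbT eq_sym; apply/eqP => lam0; move: lamn.
  by rewrite lam0 expr0n => /eqP; rewrite eq_sym pnatr_eq0 gtn_eqF.
have [U [UU UTU]] := simplex_basis R k.
have [t0 t00 det_ge1] := det_1D_ge1 k (k.+1%:R : R).
(* A slack is a difference of two entries of [Z' - Z], hence at most [t0 / k.+1]; the trace is the
   sum over [c] of the slacks, averaged over [j] and divided by [k.+1], so it stays below [t0]. *)
have e0 : 0 < t0 / (2 * k.+1%:R) by rewrite divr_gt0 ?mulr_gt0.
have [eps eps0 heps] := logits_continuous L WL Wm H1 e0.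
exists eps => // WL' Wm' H1' /heps close feas.
have tr0 : 0 <= \tr (deviation L WL Wm H1 WL' Wm' H1' U).
  rewrite (trace_deviation dnc) // mulr_ge0 ?invr_ge0 ?mulr_ge0 //.
  by do 2?apply: sumr_ge0 => ? _; apply: (slack_ge0 dnc feas).
have trt : \tr (deviation L WL Wm H1 WL' Wm' H1' U) <= t0.
  rewrite (trace_deviation dnc) // mulrC ler_pdivrMr ?mulr_gt0 ?ltr0n //.
  apply: le_trans (_ : _ <= \sum_(j < k.+1 * n) \sum_(c < k.+1) t0 / k.+1%:R) _.
    apply: ler_sum => j _; apply: ler_sum => c _.
    have := close (cls j) j; have := close c j; rewrite !ler_norml => /andP[h1 _] /andP[_ h2].
    have -> : t0 / k.+1%:R = t0 / (2 * k.+1%:R) + t0 / (2 * k.+1%:R).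
      by rewrite [LHS]splitr -mulrA -invfM [_ * 2]mulrC.
    move: h1 h2; rewrite /slack; move: (t0 / _) => t h1 h2; lra.
  rewrite !sumr_const !card_ord -!mulrnA -[leLHS]mulr_natl !natrM.
  by rewrite [leLHS]mulrC [leLHS]mulrA (mulfVK (_ : k.+1%:R != 0)) ?pnatr_eq0 // [n%:R * _]mulrC.
have det1 : 1 <= \det (1%:M + deviation L WL Wm H1 WL' Wm' H1' U).
  by apply: det_ge1; [move=> a b; apply: (deviation_le dnc)|rewrite tr0].
have := det_deviation_le n0 L0 kd dnc WL' Wm' H1' UU UTU.
rewrite (DNC_objective (ltn0Sn k) L0 dnc lam0 lamn) -lamn => hdet.
have : lam ^+ (k * L.+1) <= (objective L WL' Wm' H1' / (k * L.+1)%:R) ^+ (k * L.+1).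
  apply: le_trans hdet; rewrite mulnC exprM ler_peMr ?exprn_ge0 //.
  exact: exprn_ege1.
have obj0 : 0 <= objective L WL' Wm' H1'.
  by rewrite /objective !addr_ge0 ?frob2_ge0 // sumr_ge0 // => l _; apply: frob2_ge0.
rewrite ler_pXn2r ?muln_gt0 ?k0 // ?nnegrE ?divr_ge0 //.
rewrite ler_pdivlMr ?ltr0n ?muln_gt0 ?k0 // natrM.
have -> : k.+1%:R - 1 = k%:R :> R by rewrite -natr1 addrK.
by move=> h; apply: le_trans h; rewrite mulrCA [L.+1%:R * _]mulrC.
Qed.

End LocalMinimumTheorem.

(** * The paired competitor *)

Section PairedPoint.
Variables (R : realType) (K n d L : nat).
Hypotheses (n0 : (0 < n)%N) (L0 : (0 < L)%N) (Kd : (K <= d)%N).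
(* A class c is attached to the hidden direction c./2 with sign (-1)^c; rho (pair_size j) is the
   squared singular value of every factor in direction j. *)
Variable rho : nat -> R.
Hypotheses (rho_ge0 : forall q, 0 <= rho q) (rho0 : rho 0 = 0).
(** The logit block of a pair of size [q] is an outer product of sign vectors of lengths [q] and
    [q n]; its squared singular value [q^2 n] is shared equally by [L.+1] factors. *)
Hypothesis rhoE : forall q, (0 < q <= 2)%N -> rho q ^+ L.+1 = q%:R ^+ 2 * n%:R.

Definition pair_size (j : nat) : nat := (j.*2 < K) + (j.*2.+1 < K).

Lemma sum_pair_size j : \sum_(c < K) (c./2 == j)%:R = (pair_size j)%:R :> R.
Proof.
rewrite /pair_size; elim: K => [|m IH]; first by rewrite big_ord0.
rewrite big_ord_recr /= IH -natrD; congr (_%:R).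
have := odd_double_half m; case: eqP; case: (odd m); lia.
Qed.

Lemma pair_size_bounds (c : 'I_K) : (0 < pair_size c./2 <= 2)%N.
Proof.
rewrite /pair_size; have := ltn_ord c; have := odd_double_half c.
by case: (odd c); lia.
Qed.

Let sz (j : nat) : R := (pair_size j)%:R.
(** Scaled so that, in a nonempty direction [j], column [j] of [WL] ([sz j] entries), row [j] of
    [H1] ([sz j * n] entries) and the diagonal entry of the middle factors all have squared norm
    [rho (pair_size j)]. *)
Let g j : R := Num.sqrt (rho (pair_size j)).
Let p j : R := Num.sqrt (rho (pair_size j) / sz j).
Let r j : R := Num.sqrt (rho (pair_size j) / (sz j * n%:R)).

Definition paired_WL : 'M[R]_(K, d) :=
  \matrix_(c, j) ((c./2 == j)%:R * ((-1) ^+ c * p j)).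
Definition paired_Wm (l : nat) : 'M[R]_d := diag_mx (\row_j g j).
Definition paired_H1 : 'M[R]_(d, K * n) :=
  \matrix_(j, i) (((cls i)./2 == j)%:R * ((-1) ^+ cls i * r j)).

Lemma paired_mid_prod m : mid_prod paired_Wm m = diag_mx (\row_j g j ^+ m).
Proof.
elim: m => [|m IH] /=.
  by apply/matrixP => i j; rewrite !mxE expr0.
by rewrite IH mulmx_diag; congr diag_mx; apply/rowP => j; rewrite !mxE exprS.
Qed.

Lemma paired_weights (c : 'I_K) : p c./2 * g c./2 ^+ L.-1 * r c./2 = 1.
Proof.
rewrite /p /g /r /sz; set q := pair_size _; have qb := pair_size_bounds c.
have q0 : q%:R != 0 :> R by rewrite pnatr_eq0 -lt0n; case/andP: qb.
have nz : n%:R != 0 :> R by rewrite pnatr_eq0 -lt0n.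
apply/eqP; rewrite -(@pexpr_eq1 _ _ 2) ?mulr_ge0 ?exprn_ge0 ?sqrtr_ge0 //.
rewrite !exprMn exprAC !sqr_sqrtr ?divr_ge0 ?mulr_ge0 //.
have -> : rho q / q%:R * rho q ^+ L.-1 * (rho q / (q%:R * n%:R)) =
    (rho q * (rho q * rho q ^+ L.-1)) / (q%:R ^+ 2 * n%:R).
  by field; rewrite q0 nz.
by rewrite -!exprS prednK // rhoE // mulfV // mulf_neq0 ?expf_neq0.
Qed.

Lemma paired_logitsE c i : logits L paired_WL paired_Wm paired_H1 c i =
  (c./2 == (cls i)./2)%:R * ((-1) ^+ c * (-1) ^+ cls i).
Proof.
have cd : (c./2 < d)%N by have := ltn_ord c; lia.
rewrite /logits paired_mid_prod mul_mx_diag mxE (bigD1 (Ordinal cd)) //= big1.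
  rewrite addr0 !mxE eqxx mul1r [(_./2 == _)%N]eq_sym.
  have := paired_weights c; rewrite -mulrA => w.
  by rewrite -[RHS]mulr1 -w; ring.
move=> j; rewrite -val_eqE /= eq_sym => /negbTE jc.
by rewrite !mxE jc !mul0r.
Qed.

(** The true class has logit 1, its partner -1 and all other classes 0, so the margins are 2 or
    1. *)
Lemma paired_feasible : feasible L paired_WL paired_Wm paired_H1.
Proof.
move=> c c' i cc; rewrite !paired_logitsE cls_col_idx eqxx mul1r -expr2 sqrr_sign.
case: eqP => [e|_]; last by rewrite mul0r subr0.
rewrite mul1r -signr_odd -[(-1) ^+ c]signr_odd -signr_addb.
suff -> : odd c' (+) odd c = true by rewrite expr1 opprK lerDl.
have := odd_double_half c; have := odd_double_half c'; move: cc; rewrite -val_eqE /= e.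
by case: (odd c); case: (odd c'); lia.
Qed.

Let T := \sum_(c < K) rho (pair_size c./2) / sz c./2.

Lemma paired_objective :
  objective L paired_WL paired_Wm paired_H1 = L.+1%:R * T.
Proof.
have nz : n%:R != 0 :> R by rewrite pnatr_eq0 -lt0n.
have row_sum (F : nat -> R) (c : 'I_K) (s : nat) :
    \sum_(j < d) ((c./2 == j)%:R * ((-1) ^+ s * F j)) ^+ 2 = F c./2 ^+ 2.
  have cd : (c./2 < d)%N by have := ltn_ord c; lia.
  rewrite (bigD1 (Ordinal cd)) //= big1 ?addr0 => [|j].
    by rewrite eqxx mul1r exprMn sqrr_sign mul1r.
  by rewrite -val_eqE /= eq_sym => /negbTE ->; rewrite mul0r expr0n.
have hWL : frob2 paired_WL = T.
  apply: eq_bigr => c _; rewrite -[RHS](sqr_sqrtr (divr_ge0 (rho_ge0 _) (ler0n _ _))).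
  rewrite -(row_sum p c c); apply: eq_bigr => j _; by rewrite mxE.
have hH : frob2 paired_H1 = T.
  rewrite -frob2_tr /frob2.
  rewrite (eq_bigr (fun i => r (cls i)./2 ^+ 2)) => [|i _]; last first.
    by rewrite -(row_sum r (cls i) (cls i)); apply: eq_bigr => j _; rewrite !mxE.
  rewrite (sum_cls n (fun c => r c./2 ^+ 2)) mulr_sumr; apply: eq_bigr => c _.
  rewrite sqr_sqrtr ?divr_ge0 ?mulr_ge0 // invfM mulrCA [n%:R * _]mulrC -mulrA.
  by rewrite mulVf // mulr1.
have hWm l : frob2 (paired_Wm l) = T.
  transitivity (\sum_(j < d) rho (pair_size j)).
    apply: eq_bigr => j _; rewrite (bigD1 j) //= big1 ?addr0 => [|i ij].
      by rewrite !mxE eqxx mulr1n sqr_sqrtr.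
    by rewrite !mxE eq_sym (negbTE ij) mulr0n expr0n.
  (* Each [rho (pair_size j)] is shared out among the classes of direction [j]; empty directions
     vanish by [rho0]. *)
  rewrite (eq_bigr (fun j : 'I_d => \sum_(c < K) (c./2 == j)%:R * (rho (pair_size j) / sz j))).
    rewrite exchange_big /=; apply: eq_bigr => c _.
    have cd : (c./2 < d)%N by have := ltn_ord c; lia.
    rewrite (bigD1 (Ordinal cd)) //= big1 ?addr0 => [|j]; first by rewrite eqxx mul1r.
    by rewrite -val_eqE /= eq_sym => /negbTE ->; rewrite mul0r.
  move=> j _; rewrite -mulr_suml sum_pair_size -/(sz j).
  have [z|z] := eqVneq (pair_size j) 0%N; first by rewrite z rho0 mul0r mulr0.
  by rewrite mulrC mulfVK // pnatr_eq0.
rewrite /objective hWL hH (eq_bigr (fun=> T)) // sumr_const_nat -mulr_natl.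
by case: (L) L0 => // m _; rewrite subn1 /= -!natr1; ring.
Qed.

End PairedPoint.

(** * Comparison of the two objective values *)

Lemma paired_sum (R : realType) (rho : nat -> R) k :
  \sum_(c < k.+1) rho (pair_size k.+1 c./2) / (pair_size k.+1 c./2)%:R =
  k%:R * (rho 2 / 2) + (if odd k then rho 2 / 2 else rho 1).
Proof.
rewrite big_ord_recr /= (eq_bigr (fun=> rho 2 / 2)) => [|c _]; last first.
  suff -> : pair_size k.+1 c./2 = 2%N by [].
  (* Only the last class [k] can lack a partner, and it does exactly when [k] is even. *)
  by rewrite /pair_size; have := ltn_ord c; lia.
rewrite sumr_const card_ord mulr_natl; congr (_ + _).
have -> : pair_size k.+1 k./2 = (odd k).+1.
  by rewrite /pair_size; have := odd_double_half k; case: (odd k); lia.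
by case: (odd k); rewrite ?divr1.
Qed.

(** The ratio [mu / lam] is the [L.+1]-th root of 4. The paired point wins when it is below
    [2k/(k+1)] for odd [k], or [2(k-1)/k] for even [k]. *)
Lemma DNC_not_global_min (R : realType) (k n d L : nat) (WL : 'M[R]_(k.+1, d)) Wm
    (H1 : 'M[R]_(d, k.+1 * n)) :
  (0 < n)%N -> (k < d)%N -> DNC_point L WL Wm H1 ->
  (L = 2%N /\ (5 <= k)%N) \/ ((3 <= L)%N /\ (3 <= k)%N) ->
  exists WL' Wm' H1', feasible L WL' Wm' (H1' : 'M[R]_(d, k.+1 * n)) /\
    objective L WL' Wm' H1' < objective L WL Wm H1.
Proof.
move=> n0 kd dnc hL; have L0 : (0 < L)%N by case: hL => -[]; lia.
have [lam lam_ge0 lamn] := @exists_nth_root R L n%:R (ler0n _ _).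
have [mu mu_ge0 mun] := @exists_nth_root R L (2 ^+ 2 * n%:R) (mulr_ge0 (sqr_ge0 _) (ler0n _ _)).
have lam0 : 0 < lam.
  rewrite lt_neqAle lam_ge0 andbT eq_sym; apply/eqP => lam0; move: lamn.
  by rewrite lam0 expr0n => /eqP; rewrite eq_sym pnatr_eq0 gtn_eqF.
pose rho q := if q is 0 then 0 else if q is 1 then lam else mu : R.
have rho_ge0 q : 0 <= rho q by case: q => [|[|]].
have rhoE q : (0 < q <= 2)%N -> rho q ^+ L.+1 = q%:R ^+ 2 * n%:R.
  by case: q => [|[|[|]]] // _; rewrite /rho ?lamn ?mun // expr1n mul1r.
exists (paired_WL k.+1 d rho), (paired_Wm k.+1 d rho), (paired_H1 k.+1 n d rho); split.
  exact: paired_feasible.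
rewrite paired_objective // paired_sum /= (DNC_objective _ L0 dnc lam0 lamn) //.
rewrite ltr_pM2l ?ltr0n // -[k.+1%:R]natr1 addrK.
have bound b : 0 <= b -> 4 < b ^+ L.+1 -> mu < b * lam.
  move=> b0 b4; rewrite -(@ltr_pXn2r _ L.+1) ?nnegrE ?mulr_ge0 //.
  rewrite exprMn lamn mun ltr_pM2r ?ltr0n //; apply: le_lt_trans b4.
  by rewrite -natrX ler_nat.
case: hL => -[L2 k5].
  have k5R : 5 <= k%:R :> R by rewrite ler_nat.
  (* [(8/5)^3 = 4.096 > 4], while the threshold is at least 5/3 for odd [k >= 5] and even
     [k >= 6]. *)
  have hmu : mu < 8 / 5 * lam by apply: bound; rewrite ?L2; lra.
  case: ifP => ko; first by nra.
  have : 6 <= k%:R :> R by rewrite ler_nat; move: ko k5; case: (k) => [|[|[|[|[|[|]]]]]].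
  nra.
have k3R : 3 <= k%:R :> R by rewrite ler_nat.
(* [1.42^4 > 4], while the threshold is at least 3/2 for odd [k >= 3] and even [k >= 4]. *)
have hmu : mu < 142 / 100 * lam.
  apply: bound; first lra.
  apply: lt_le_trans (_ : (142 / 100) ^+ 4 <= _); first lra.
  by rewrite ler_weXn2l //; lra.
case: ifP => ko; first by nra.
have : 4 <= k%:R :> R by rewrite ler_nat; move: ko k5; case: (k) => [|[|[|[|]]]].
nra.
Qed.

Theorem theorem3p1 (R : realType) (K n L d : nat)
  (hK : (2 <= K)%N) (hn : (1 <= n)%N) (hL : (1 <= L)%N) (hd : (K <= d)%N)
  (WL : 'M[R]_(K, d)) (Wm : nat -> 'M[R]_d) (H1 : 'M[R]_(d, K * n)) :
  DNC_point L WL Wm H1 ->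
  ((L = 2%N /\ (6 <= K)%N) \/ ((3 <= L)%N /\ (4 <= K)%N)) ->
  (exists (WL' : 'M[R]_(K, d)) (Wm' : nat -> 'M[R]_d) (H1' : 'M[R]_(d, K * n)),
      feasible L WL' Wm' H1' /\ objective L WL' Wm' H1' < objective L WL Wm H1)
  /\
  (exists eps : R, 0 < eps /\
     forall (WL' : 'M[R]_(K, d)) (Wm' : nat -> 'M[R]_d) (H1' : 'M[R]_(d, K * n)),
       param_dist L WL WL' Wm Wm' H1 H1' < eps ->
       feasible L WL' Wm' H1' ->
       objective L WL Wm H1 <= objective L WL' Wm' H1').
Proof.
move=> dnc; case: K hK hd WL H1 dnc => // k k0 kd WL' H1' dnc hL0; split.
  by apply: (DNC_not_global_min hn kd dnc); case: hL0 => -[]; [left|right].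
have [eps eps0 heps] := DNC_local_min k0 hn hL kd dnc.
by exists eps; split=> // WL2 Wm2 H2; apply: heps.
Qed.
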